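(* Let $d$ be a power of $2$ and let $f:\{0,1\}^n\to\{0,1\}$ be a function whose $\mathrm{GF}(2)$ polynomial representation has degree $d$ and contains all $\binom{n}{d}$ monomials of degree $d$ (the monomials of degree less than $d$ being arbitrary). Then the Fourier sparsity of $f$ satisfies $\|\hat f\|_0\ge 2^{d\cdot\lfloor n/d\rfloor}-1$.
   Context: For $h:\{0,1\}^n\to\mathbb{R}$ and $S\subseteq[n]$, $\hat h(S)=2^{-n}\sum_{x}h(x)(-1)^{\sum_{i\in S}x_i}$; the Fourier sparsity $\|\hat h\|_0$ is the number of $S\subseteq[n]$ with $\hat h(S)\neq0$.
   Formalization: The case d = 1 is excluded (d is a power of 2 with d ≥ 2), since for d = 1 and n ≥ 2 the parity of all n variables has Fourier sparsity 2, which is less than 2^n − 1. *)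

(* Defs.v *)
From mathcomp Require Import all_boot all_order all_algebra.
From mathcomp Require Import mpoly.
Set Implicit Arguments.
Unset Strict Implicit.
Unset Printing Implicit Defensive.
Import GRing.Theory Num.Theory.
Local Open Scope ring_scope.

Notation cube n := {ffun 'I_n -> bool}.

Definition fourier_coef (R : realFieldType) (n : nat)
    (h : cube n -> R) (S : {set 'I_n}) : R :=
  (2 ^+ n)^-1 * \sum_(x : cube n) h x * (-1) ^+ (\sum_(i in S) x i)%N.

Definition fourier_sparsity (R : realFieldType) (n : nat)
    (h : cube n -> R) : nat :=
  #|[set S : {set 'I_n} | fourier_coef h S != 0]|.

(* Multilinearity makes the representing polynomial unique: over 'F_2 the
   functions x and x ^+ 2 agree on {0,1}. *)
Definition multilinear (n : nat) (p : {mpoly 'F_2[n]}) : Prop :=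
  forall m : 'X_{1..n}, m \in msupp p -> forall i : 'I_n, (m i <= 1)%N.

Definition gf2_representation (n : nat) (f : cube n -> bool)
    (p : {mpoly 'F_2[n]}) : Prop :=
  multilinear p /\
  forall x : cube n, p.@[fun i : 'I_n => (x i)%:R] = (f x)%:R.

(* mesym1 S is the exponent vector of the monomial \prod_(i in S) 'X_i. *)
Definition contains_all_monomials (n d : nat) (p : {mpoly 'F_2[n]}) : Prop :=
  forall S : {set 'I_n}, #|S| = d -> mesym1 S \in msupp p.

(* Main.v *)
Require Import Defs.
From mathcomp Require Import all_boot all_order all_algebra.
From mathcomp Require Import mpoly zify ring.
Set Implicit Arguments.
Unset Strict Implicit.
Unset Printing Implicit Defensive.
Import GRing.Theory Num.Theory.
Local Open Scope ring_scope.

(* Write n = d m + r with r < d and fix a set D of d m variables. For every S, the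
   points supported in D satisfy (-1)^(f(x) + S.x) = prod_A (1 - 2 [A <= x]),
   where A runs over the monomials of f(x) + S.x. Expanding the product, the sum
   over x is sum_F (-2)^|F| 2^(d m - |cover F|), F running over the sets of
   monomials covering only variables of D. As |A| <= d and d >= 2, a term is
   divisible by 2^(m+1) unless F partitions D into m sets of size d. All d-sets
   are monomials, so modulo 2^(m+1) the sum is (-2)^m times the number of such
   partitions, which is odd because d is a power of 2. Hence the restriction of
   f to D has no zero Fourier coefficient at a nonempty S; this coefficient is a
   multiple of a sum of coefficients of f at sets U with U cap D = S, so distinct
   S yield distinct U in the spectrum of f. *)

(** * Parity of the number of partitions into blocks of size 2^k *)

(** Induction on j by Pascal's rule: with N = 2^k m and j+1 < 2^k, C(N, j+1) is even, since 2^k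
    divides (j+1) C(N, j+1) = N C(N-1, j) and would be coprime to an odd C(N, j+1). *)
Lemma odd_bin_pow2 (k m j : nat) :
  (0 < m)%N -> (j < 2 ^ k)%N -> odd 'C((2 ^ k * m).-1, j).
Proof.
move=> m_gt0; elim: j => [|j IHj] ltj; first by rewrite bin0.
have N_gt0 : (0 < 2 ^ k * m)%N by rewrite muln_gt0 expn_gt0.
have evenC : ~~ odd 'C(2 ^ k * m, j.+1).
  apply/negP => oddC.
  have : (2 ^ k %| j.+1 * 'C(2 ^ k * m, j.+1))%N.
    by rewrite -mul_bin_diag -mulnA dvdn_mulr.
  by rewrite Gauss_dvdl ?coprimeXl ?coprime2n // gtnNdvd.
have := evenC; rewrite -{1}(prednK N_gt0) binS oddD (IHj (ltnW ltj)).
by case: odd.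
Qed.

Lemma card_draws_containing (T : finType) (D : {set T}) (x : T) (j : nat) :
  x \in D ->
  #|[set B : {set T} | [&& B \subset D, x \in B & #|B| == j.+1]]|
    = 'C(#|D|.-1, j).
Proof.
move=> xD.
have -> : #|D|.-1 = #|D :\ x| by rewrite (cardsD1 x D) xD.
rewrite -cards_draws.
rewrite -[RHS](card_in_imset (f := fun A : {set T} => x |: A)); last first.
  move=> A B; rewrite !inE => /andP[sA _] /andP[sB _] eqAB.
  have xN (C : {set T}) : C \subset D :\ x -> x \notin C.
    by move=> sC; apply/negP => /(subsetP sC); rewrite !inE eqxx.
  by rewrite -(setU1K (xN _ sA)) eqAB (setU1K (xN _ sB)).
apply: eq_card => B; rewrite !inE; apply/and3P/imsetP.
  case=> sB xB cB; exists (B :\ x); last by rewrite setD1K.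
  by rewrite inE setSD //= -eqSS -(eqP cB) (cardsD1 x B) xB.
case=> A; rewrite !inE => /andP[]; rewrite subsetD1 => /andP[sA xA] /eqP cA ->.
by rewrite setU11 cardsU1 xA cA eqxx subUset sub1set xD sA.
Qed.

Definition uniform_partitions (T : finType) (d : nat) (D : {set T}) :
    {set {set {set T}}} :=
  [set P | partition P D & [forall B in P, #|B| == d]].

(* Classify the partitions by the block containing x. *)
Lemma card_uniform_partitions_rec (T : finType) (d : nat) (D : {set T}) (x : T) :
  x \in D ->
  #|uniform_partitions d D| =
  (\sum_(B : {set T} | [&& B \subset D, x \in B & #|B| == d])
     #|uniform_partitions d (D :\: B)|)%N.
Proof.
move=> xD; rewrite -sum1_card.
rewrite (partition_big (fun P => pblock P x)
  (fun B => [&& B \subset D, x \in B & #|B| == d])); last first.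
  move=> P; rewrite inE => /andP[partP /forall_inP unifP].
  have xP : x \in cover P by rewrite (cover_partition partP).
  by rewrite (partitionS partP) ?pblock_mem // mem_pblock xP unifP ?pblock_mem.
apply: eq_bigr => B /and3P[sBD xB cB]; rewrite sum1_card.
(* Adding the block [B] is a bijection from the uniform partitions of [D :\: B] to those of [D]
   whose block through [x] is [B]. *)
rewrite -(card_in_imset (f := fun P => B |: P) (D := uniform_partitions _ _)).
  apply: eq_card => P; rewrite unfold_in /=; apply/andP/imsetP.
    rewrite inE => -[/andP[partP /forall_inP unifP] /eqP defB].
    have BP : B \in P by rewrite -defB pblock_mem // (cover_partition partP).
    exists (P :\ B); last by rewrite setD1K.
    rewrite inE partitionD1 //=; apply/forall_inP => C.
    by rewrite inE => /andP[_ /unifP].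
  case=> Q; rewrite inE => /andP[partQ /forall_inP unifQ] ->.
  have part : partition (B |: Q) D.
    have -> : D = B :|: (D :\: B) by rewrite -{1}(setID D B) (setIidPr sBD).
    apply: partitionU1 => //; first by apply/set0Pn; exists x.
    by rewrite -setI_eq0 setIDA setDIl setDv set0I.
  split; last first.
    by rewrite (def_pblock (partition_trivIset part) _ xB) ?setU11.
  rewrite inE part; apply/forall_inP => C; rewrite !inE => /orP[/eqP->|/unifQ] //.
move=> P Q; rewrite !inE => /andP[partP _] /andP[partQ _] eqPQ.
have BN R : partition R (D :\: B) -> B \notin R.
  move=> partR; apply/negP => /(partitionS partR)/subsetP/(_ _ xB).
  by rewrite inE xB.
by rewrite -(setU1K (BN _ partP)) eqPQ (setU1K (BN _ partQ)).
Qed.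

(** By induction on m, each block through a fixed point extends to an odd number of partitions. The
    parity is thus that of the number of such blocks, a binomial coefficient covered by
    [odd_bin_pow2]. *)
Lemma odd_card_uniform_partitions (T : finType) (k m : nat) (D : {set T}) :
  #|D| = (2 ^ k * m)%N -> odd #|uniform_partitions (2 ^ k) D|.
Proof.
elim: m D => [|m IHm] D cD.
  move: cD; rewrite muln0 => /eqP; rewrite cards_eq0 => /eqP->.
  rewrite (_ : uniform_partitions _ _ = [set set0]) ?cards1 //.
  apply/setP => P; rewrite !inE partition_set0; case: eqP => //= ->.
  by apply/forall_inP => B; rewrite inE.
have [x xD] : {x | x \in D}.
  by apply/sigW/set0Pn; rewrite -card_gt0 cD muln_gt0 expn_gt0.
rewrite (card_uniform_partitions_rec _ xD) (big_morph odd oddD (erefl _)).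
rewrite (eq_bigr (fun=> odd 1)) => [|B /and3P[sB _ /eqP cB]]; last first.
  by apply: IHm; rewrite cardsDS // cD cB mulnS addKn.
rewrite -(big_morph odd oddD (erefl _)) sum1dep_card -(prednK (expn_gt0 2 k)).
by rewrite card_draws_containing // cD odd_bin_pow2 // ltn_predL expn_gt0.
Qed.

(** * Signed sums over subsets and over families of sets *)

Lemma prod_1D_subsets (R : comPzRingType) (T : finType) (K : {set T}) (y : T -> R) :
  \prod_(i in K) (1 + y i) = \sum_(J : {set T} | J \subset K) \prod_(i in J) y i.
Proof.
rewrite big_mkcond (eq_bigr (fun i => (if i \in K then y i else 0) + 1)).
  rewrite bigA_distr [RHS]big_mkcond; apply: eq_bigr => J _ /=.
  rewrite -big_mkcond /=; case: ifPn => [/subsetP sJK | /subsetPn[i iJ iK]].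
    by apply: eq_bigr => i /sJK ->.
  by rewrite (bigD1 i) //= (negbTE iK) mul0r.
by move=> i _; case: ifP; rewrite addrC ?add0r ?addr0.
Qed.

Lemma exp_1D_subsets (R : comPzRingType) (T : finType) (K : {set T}) (a : R) :
  (1 + a) ^+ #|K| = \sum_(J : {set T} | J \subset K) a ^+ #|J|.
Proof.
rewrite -prodr_const prod_1D_subsets.
by apply: eq_bigr => J _; rewrite prodr_const.
Qed.

(** The sum factors over i in [K]: the factor is 2 if i is outside [X], and 1 - 1 = 0 otherwise. *)
Lemma sum_sign_subsets (R : comPzRingType) (T : finType) (K X : {set T}) :
  \sum_(J : {set T} | J \subset K) (-1) ^+ #|J :&: X| =
  if [disjoint K & X] then 2 ^+ #|K| else 0 :> R.
Proof.
transitivity (\prod_(i in K) (1 + (if i \in X then -1 else 1)) : R).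
  rewrite prod_1D_subsets; apply: eq_bigr => J _.
  rewrite -big_mkcondr -prodr_const /=.
  by apply: eq_bigl => i; rewrite inE.
case: ifPn => [KX | /pred0Pn[i /andP[/= iK iX]]].
  rewrite -prodr_const; apply: eq_bigr => i iK.
  by rewrite (disjointFr KX iK).
by rewrite (bigD1 i) //= iX addrC addNr mul0r.
Qed.

Lemma card_between (T : finType) (C D : {set T}) : C \subset D ->
  #|[set X : {set T} | (C \subset X) && (X \subset D)]| = (2 ^ (#|D| - #|C|))%N.
Proof.
move=> sCD; rewrite -cardsDS // -card_powerset.
rewrite -(card_in_imset (f := fun A : {set T} => C :|: A)
  (D := powerset (D :\: C))).
  apply: eq_card => X; rewrite inE; apply/andP/imsetP.
    case=> sCX sXD; exists (X :\: C); first by rewrite inE setSD.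
    by rewrite -{1}(setID X C) (setIidPr sCX).
  case=> A; rewrite inE subsetD => /andP[sA _] ->.
  by rewrite subsetUl subUset sCD.
have CK A : A \in powerset (D :\: C) -> (C :|: A) :\: C = A.
  rewrite inE subsetD => /andP[_ dis].
  by rewrite setDUl setDv set0U; apply/setDidPl.
by move=> A B AD BD eqAB; rewrite -(CK A) // eqAB CK.
Qed.

(** Expand each power of -1 = 1 + (-2) over subfamilies F and exchange the sums; the power of 2
    counts the X between [cover F] and [D]. *)
Lemma sum_sign_family (T : finType) (D : {set T}) (E : {set {set T}}) :
  \sum_(X : {set T} | X \subset D) (-1) ^+ #|[set A in E | A \subset X]| =
  \sum_(F : {set {set T}} | (F \subset E) && (cover F \subset D))
     (-2) ^+ #|F| * 2 ^+ (#|D| - #|cover F|) :> int.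
Proof.
transitivity (\sum_(X : {set T} | X \subset D) \sum_(F : {set {set T}} |
    (F \subset E) && (cover F \subset X)) ((-2) ^+ #|F| : int)).
  apply: eq_bigr => X _.
  rewrite (_ : -1 = 1 + (-2)) // exp_1D_subsets; apply: eq_bigl => F.
  apply/subsetP/andP => [sF | [/subsetP sFE /bigcupsP sFX] A AF].
    by split; [apply/subsetP | apply/bigcupsP] => A /sF; rewrite inE => /andP[].
  by rewrite inE sFE // sFX.
rewrite (exchange_big_dep (fun F : {set {set T}} => (F \subset E) && (cover F \subset D))) /=.
  apply: eq_bigr => F /andP[sFE sFD].
  rewrite -natrX -(card_between sFD) mulr_natr sumr_const.
  congr (_ *+ _); apply: eq_card => X; rewrite unfold_in inE sFE /= andbC //.
by move=> X F sXD /andP[-> sFX]; apply: subset_trans sXD.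
Qed.

Lemma sum_sign_family_neq0 (T : finType) (k m : nat) (D : {set T})
    (E : {set {set T}}) :
  (0 < k)%N -> #|D| = (2 ^ k * m)%N ->
  (forall A, A \in E -> (#|A| <= 2 ^ k)%N) ->
  (forall A : {set T}, #|A| = (2 ^ k)%N -> A \in E) ->
  \sum_(X : {set T} | X \subset D)
     (-1) ^+ #|[set A in E | A \subset X]| != 0 :> int.
Proof.
move=> k_gt0 cD Ele Eeq; set d := (2 ^ k)%N in cD Ele Eeq *.
have d_gt1 : (1 < d)%N by rewrite -(expn0 2) ltn_exp2l.
apply/eqP => sum0.
(* A zero sum would be divisible by 2^(m+1). The terms that are not uniform partitions are shown to
   be multiples of 2^(m+1), so the remaining ones would also sum to a multiple. *)
have := dvdz0 (2 ^+ m.+1).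
rewrite -sum0 sum_sign_family (bigID (mem (uniform_partitions d D))) /=.
rewrite rpredDr; last first.
  apply: rpred_sum => F /andP[/andP[/subsetP sFE sFD] notpart].
  rewrite dvdzE abszM !abszX /= -expnD dvdn_exp2l //.
  have le1 := leq_card_cover F.
  have le2 : (\sum_(A in F) #|A| <= \sum_(A in F) d
      ?= iff [forall A in F, #|A| == d])%N.
    apply: leqif_sum => A /sFE /Ele le; exact: leqif_eq.
  have le3 := leqif_trans le1 le2; rewrite sum_nat_const in le3.
  have [le4 eq4] := le3.
  have le5 := subset_leq_card sFD.
  have : (#|F| == m) && (#|cover F| == #|D|) = false.
    apply: contraNF notpart => /andP[/eqP cF /eqP ccF].
    move: eq4; rewrite cF ccF cD mulnC eqxx => /esym /andP[triv unif].
    rewrite inE unif andbT /partition triv eqEcard sFD ccF leqnn /=.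
    apply/negP => /(forall_inP unif); rewrite cards0 => /eqP d0.
    by rewrite -d0 in d_gt1.
  rewrite cD in le5 *; move: le4 le5; move: #|F| #|cover F| => t c.
  (* The goal is m < t + (d m - c), where c <= t d. If t < m, then d m - c >= 2 (m - t); if t > m it
     is immediate; if t = m, then c < d m because F is not a uniform partition. *)
  case: (ltngtP t m) => [lt_tm|lt_mt|->] /=; [nia | lia |].
  rewrite mulnC; lia.
rewrite (eq_bigr (fun=> (-2) ^+ m)); last first.
  move=> F /andP[_]; rewrite inE => /andP[part /forall_inP unif].
  have : (#|D| = #|F| * d)%N.
    by apply: card_uniform_partition part => A /unif /eqP.
  rewrite (cover_partition part) subnn expr0 mulr1 cD mulnC.
  by move/eqP; rewrite eqn_pmul2r => [/eqP->|]; last exact: ltnW.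
rewrite (eq_bigl (mem (uniform_partitions d D))) => [|F]; last first.
  rewrite andb_idl // inE => /andP[part /forall_inP unif].
  rewrite (cover_partition part) subxx andbT; apply/subsetP => A /unif /eqP cA.
  exact: Eeq.
(* What remains is (-2)^m times the number of uniform partitions, so that number would have to be
   even. *)
rewrite sumr_const -[_ *+ _]mulr_natr dvdzE abszM !abszX /= natz.
rewrite expnSr dvdn_pmul2l ?expn_gt0 // dvdn2.
by rewrite (odd_card_uniform_partitions cD).
Qed.

(** * Multilinear polynomials over GF(2) as families of sets *)

Definition monomials (n : nat) (p : {mpoly 'F_2[n]}) : {set {set 'I_n}} :=
  [set A | mesym1 A \in msupp p].

Definition indicator (n : nat) (X : {set 'I_n}) : cube n := [ffun i => i \in X].

Lemma indicator_bij (n : nat) : bijective (@indicator n).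
Proof.
exists (fun x : cube n => [set i | x i]) => [X|x].
  by apply/setP => i; rewrite inE ffunE.
by apply/ffunP => i; rewrite ffunE inE.
Qed.

Lemma F2_nat_inj (b c : nat) : b%:R = c%:R :> 'F_2 -> odd b = odd c.
Proof.
move=> /(congr1 val) /=; rewrite !val_Fp_nat // !modn2.
by case: (odd b); case: (odd c).
Qed.

(** Nonzero coefficients in ['F_2] are 1, and at [indicator X] the monomial of A takes the value 1
    exactly when A lies in X; the value of [p] therefore counts such monomials modulo 2. *)
Lemma gf2_representation_odd (n : nat) (f : cube n -> bool) (p : {mpoly 'F_2[n]})
    (X : {set 'I_n}) :
  gf2_representation f p ->
  f (indicator X) = odd #|[set A in monomials p | A \subset X]|.
Proof.
case=> mlin pf; have := pf (indicator X); rewrite mevalE => eq_f.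
rewrite -[LHS]oddb; apply: F2_nat_inj; rewrite -eq_f -sum1_card natr_sum.
have inj : {in predT &, injective (@mesym1 n)} by move=> A B _ _ /inj_mesym1.
have supp_mesym m : m \in msupp p -> m = mesym1 [set i | m i == 1%N].
  move=> mp; apply/mnmP => i; rewrite mnmE inE.
  by case: (m i) (mlin m mp i) => [|[]].
transitivity (\sum_(m <- [seq mesym1 A | A <- enum (monomials p)])
    p@_m * \prod_(i < n) (indicator X i)%:R ^+ m i).
  apply: perm_big; apply: uniq_perm; rewrite ?msupp_uniq //.
    by rewrite map_inj_uniq ?enum_uniq //; exact: inj_mesym1.
  move=> m; apply/idP/mapP => [mp | [A]].
    exists [set i | m i == 1%N]; rewrite -?supp_mesym //.
    by rewrite mem_enum inE -supp_mesym.
  by rewrite mem_enum inE => Ap ->.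
rewrite big_map big_enum /= [RHS](eq_bigl
  (fun A => (A \in monomials p) && (A \subset X))); last by move=> A; rewrite !inE.
rewrite [RHS]big_mkcondr /=; apply: eq_bigr => A; rewrite inE => Ap.
have -> : p@_(mesym1 A) = 1.
  move: Ap; rewrite mcoeff_msupp; case: (p@_(mesym1 A)) => -[|[|//]] lt1 // _.
    exact: val_inj.
rewrite mul1r; case: ifPn => [/subsetP sAX | /subsetPn[i iA iX]].
  apply: big1 => i _; rewrite mnmE ffunE; case: (boolP (i \in A)) => [/sAX->|] //.
by rewrite (bigD1 i) //= mnmE ffunE iA (negbTE iX) mul0r.
Qed.

(** * Fourier coefficients of the restriction to D *)

Lemma odd_card_addb (T : finType) (A B : {set T}) :
  odd #|[set x | (x \in A) (+) (x \in B)]| = odd #|A| (+) odd #|B|.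
Proof.
have oddE (C : {set T}) : odd #|C| = \big[addb/false]_x (x \in C).
  rewrite -sum1_card (big_morph odd oddD (erefl _)) [LHS]big_mkcond.
  by apply: eq_bigr => x _; case: ifP.
by rewrite !oddE -big_split; apply: eq_bigr => x _; rewrite inE.
Qed.

Lemma sum_sign_restriction_neq0 (n k m : nat) (f : cube n -> bool)
    (p : {mpoly 'F_2[n]}) (D S : {set 'I_n}) :
  (0 < k)%N -> gf2_representation f p -> msize p = (2 ^ k).+1 ->
  contains_all_monomials (2 ^ k) p -> #|D| = (2 ^ k * m)%N ->
  \sum_(X : {set 'I_n} | X \subset D)
     (-1) ^+ f (indicator X) * (-1) ^+ #|S :&: X| != 0 :> int.
Proof.
move=> k_gt0 fp sp allp cD; set d := (2 ^ k)%N in sp allp cD *.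
have d_gt1 : (1 < d)%N by rewrite -(expn0 2) ltn_exp2l.
(* [E] is the monomial set of f + S.x: addition over GF(2) is symmetric difference. As d > 1, the
   singletons neither exceed size d nor cancel a d-set. *)
pose E := [set A | (A \in monomials p) (+) (A \in set1 @: S)].
have card1 A : A \in set1 @: S -> #|A| = 1%N by case/imsetP => i _ ->; rewrite cards1.
rewrite (eq_bigr (fun X : {set 'I_n} => (-1) ^+ #|[set A in E | A \subset X]|)).
  apply: (sum_sign_family_neq0 k_gt0 cD) => [A | A cA]; rewrite inE.
    case: (boolP (A \in set1 @: S)) => [/card1-> _ | _]; first exact: ltnW.
    by rewrite addbF inE => /msize_mdeg_lt; rewrite mdeg_mesym1 sp.
  rewrite inE allp //; case: (boolP (A \in _)) => // /card1 A1.
  by rewrite /d -cA A1 in d_gt1.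
move=> X _; rewrite (gf2_representation_odd _ fp) signr_odd -exprD.
rewrite -signr_odd oddD -[RHS]signr_odd; congr (_ ^+ (nat_of_bool _)).
rewrite (_ : #|S :&: X| = #|[set A in set1 @: S | A \subset X]|).
  rewrite -odd_card_addb; congr (odd _); apply: eq_card => A.
  by rewrite !inE; case: (A \subset X); rewrite ?andbT ?andbF.
rewrite -(card_imset _ set1_inj); apply: eq_card => A; rewrite inE.
apply/imsetP/andP => [[i] | [/imsetP[i iS ->]]].
  by rewrite inE => /andP[iS iX] ->; rewrite imset_f // sub1set.
by rewrite sub1set => iX; exists i; rewrite // inE iS.
Qed.

(* Averaging over the T outside D restricts h to the points supported in D. *)
Lemma sum_fourier_coef_restriction (R : realFieldType) (n : nat) (h : cube n -> R)
    (D S : {set 'I_n}) :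
  \sum_(T : {set 'I_n} | T \subset ~: D) fourier_coef h (S :&: D :|: T) =
  (2 ^+ n)^-1 * 2 ^+ #|~: D| *
  \sum_(X : {set 'I_n} | X \subset D)
     h (indicator X) * (-1) ^+ #|S :&: X|.
Proof.
have dotE (U X : {set 'I_n}) : (\sum_(i in U) indicator X i)%N = #|U :&: X|.
  rewrite -sum1_card [LHS]big_mkcond [RHS]big_mkcond.
  by apply: eq_bigr => i _; rewrite ffunE inE; do 2 case: (i \in _).
rewrite -mulr_sumr -mulrA; congr (_ * _).
rewrite exchange_big /= (reindex _ (onW_bij _ (@indicator_bij n))) /=.
rewrite mulr_sumr [RHS]big_mkcond; apply: eq_bigr => X _.
rewrite -mulr_sumr.
transitivity (h (indicator X) * ((-1) ^+ #|S :&: D :&: X| *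
    \sum_(T : {set 'I_n} | T \subset ~: D) (-1) ^+ #|T :&: X|)).
  congr (_ * _); rewrite mulr_sumr; apply: eq_bigr => T sTD.
  rewrite dotE -exprD setIUl cardsU [X in (_ - X)%N](_ : _ = 0%N) ?subn0 //.
  apply/eqP; rewrite cards_eq0 setI_eq0.
  apply: disjointWl (subsetIl _ _) _; apply: disjointWr (subsetIl _ _) _.
  apply: disjointWl (subsetIr _ _) _; rewrite disjoint_sym.
  by rewrite disjoints_subset.
rewrite sum_sign_subsets disjoint_sym disjoints_subset setCK.
case: ifP => sXD; last by rewrite !mulr0.
by rewrite -setIA (setIidPr sXD) mulrA mulrC.
Qed.

(** If the coefficients at all U with [U :&: D = S] vanished, so would the restricted sum of f, and
    then that of (-1)^f, against [sum_sign_restriction_neq0]. *)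
Lemma exists_fourier_coef_neq0 (R : realFieldType) (n k m : nat)
    (f : cube n -> bool) (p : {mpoly 'F_2[n]}) (D S : {set 'I_n}) :
  (0 < k)%N -> gf2_representation f p -> msize p = (2 ^ k).+1 ->
  contains_all_monomials (2 ^ k) p -> #|D| = (2 ^ k * m)%N ->
  S \subset D -> S != set0 ->
  exists2 U : {set 'I_n}, U :&: D = S &
    fourier_coef (fun x => (f x)%:R : R) U != 0.
Proof.
move=> k_gt0 fp sp allp cD sSD S0.
case: (pickP (fun U : {set 'I_n} => (U :&: D == S) &&
    (fourier_coef (fun x => (f x)%:R : R) U != 0))) => [U /andP[/eqP]|noU].
  by exists U.
have := sum_fourier_coef_restriction (fun x => (f x)%:R : R) D S.
rewrite big1 => [|T sTD]; last first.
  apply/eqP; move: (noU (S :&: D :|: T)); rewrite setIUl -setIA setIid.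
  rewrite (setIidPl sSD) [T :&: D](_ : _ = set0) ?setU0 ?eqxx => [/negbFE //|].
  by apply/eqP; rewrite setI_eq0 disjoints_subset.
move/esym/eqP; rewrite !mulf_eq0 invr_eq0 !expf_eq0 pnatr_eq0 !andbF /=.
move=> /eqP sumf.
have := sum_sign_restriction_neq0 S k_gt0 fp sp allp cD.
rewrite -(intr_eq0 R) rmorph_sum /=.
suff -> : \sum_(X : {set 'I_n} | X \subset D)
    (((-1) ^+ f (indicator X) * (-1) ^+ #|S :&: X| : int)%:~R : R) = 0.
  by rewrite eqxx.
(* By (-1)^f = 1 - 2 f. The constant 1 contributes 0 because S is a nonempty subset of D; at the
   empty set it would contribute 2^#|D|. *)
transitivity (\sum_(X : {set 'I_n} | X \subset D) (-1) ^+ #|X :&: S| - 2 *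
   \sum_(X : {set 'I_n} | X \subset D) (f (indicator X))%:R * (-1) ^+ #|S :&: X| : R).
  rewrite mulr_sumr -sumrB; apply: eq_bigr => X _.
  rewrite rmorphM !rmorphXn rmorphN1 setIC mulrA -[X in X - _]mul1r -mulrBl.
  by congr (_ * _); case: (f _) => /=; ring.
rewrite sumf mulr0 subr0 sum_sign_subsets; case: ifP => //.
rewrite disjoint_sym -setI_eq0 (setIidPl sSD) => S0'.
by rewrite S0' in S0.
Qed.

(* msize p is the degree of p plus one. The value d = 1 is excluded: for it the
   inequality fails on the parity of n >= 2 variables, of sparsity 2. *)
Theorem theorem5p1 (R : realFieldType) (n d k : nat)
    (hd : d = (2 ^ k)%N) (hd1 : (1 < d)%N)
    (f : cube n -> bool) (p : {mpoly 'F_2[n]})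
    (hp : gf2_representation f p)
    (hdeg : msize p = d.+1)
    (hall : contains_all_monomials d p) :
  (2 ^ (d * (n %/ d)) - 1 <= fourier_sparsity (fun x : cube n => (f x)%:R : R))%N.
Proof.
have k_gt0 : (0 < k)%N by case: k hd => // d1; rewrite d1 in hd1.
have [D cD] : exists D : {set 'I_n}, #|D| = (d * (n %/ d))%N.
  have le_n : (d * (n %/ d) <= #|[set: 'I_n]|)%N.
    by rewrite cardsT card_ord mulnC leq_trunc_div.
  have : (0 < #|[set A : {set 'I_n} | A \subset setT & #|A| == (d * (n %/ d))%N]|)%N.
    by rewrite cards_draws bin_gt0.
  by case/card_gt0P => D; rewrite inE => /andP[_ /eqP]; exists D.
(* The subtracted 1 is the empty set. Every nonempty subset of [D] is the trace on [D] of a set in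
   the spectrum, so the spectrum has at least that many elements. *)
rewrite -cD -card_powerset subn1 (cardsD1 set0) inE sub0set /=.
apply: leq_trans (leq_imset_card (fun U => U :&: D) _).
apply: subset_leq_card; apply/subsetP => S; rewrite !inE => /andP[S0 sSD].
rewrite hd in hdeg hall cD.
have [U <- U0] := exists_fourier_coef_neq0 R k_gt0 hp hdeg hall cD sSD S0.
by apply/imsetP; exists U; rewrite ?inE.
Qed.
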